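(* Let $p\ge 1$, and let $\Lambda\in C^0([0,\infty))$ be strictly increasing and such that $$\frac{\Lambda(s)}{\ln s}\to+\infty\qquad\text{as }s\to\infty.$$ Moreover, assume that $u$ is a positive classical solution of $$u_t=u^p\Delta u\ \ (x\in\mathbb{R}^n,\ t>0),\qquad u(x,0)=u_0(x)\ \ (x\in\mathbb{R}^n)$$ in $\mathbb{R}^n\times(0,\infty)$, with initial data $u_0\in C^0(\mathbb{R}^n)$ satisfying $$u_0(x)\ge e^{-\Lambda(|x|)}\qquad\text{for all }x\in\mathbb{R}^n.$$ Then there exist $t_0>0$ and $C>0$ such that $$\|u(\cdot,t)\|_{L^\infty(\mathbb{R}^n)}\ge C\,t^{-\frac1p}\Big\{\Lambda^{-1}\big(C\ln t\big)\Big\}^{\frac2p}\qquad\text{for all }t\ge t_0,$$ where $\Lambda^{-1}$ denotes the inverse of $\Lambda$.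
   Context: A positive classical solution in $\mathbb{R}^n\times(0,\infty)$ is a positive function $u\in C^0(\mathbb{R}^n\times[0,\infty))\cap C^{2,1}(\mathbb{R}^n\times(0,\infty))$ satisfying the equation and the initial condition pointwise. The inverse $\Lambda^{-1}$ is defined on the range $[\Lambda(0),\infty)$ of $\Lambda$; part of the conclusion is that $C\ln t$ lies in this range for $t\ge t_0$. *)

(* Defs.v *)
From HB Require Import structures.
From mathcomp Require Import all_boot all_order all_algebra.
From mathcomp Require Import all_classical all_reals all_analysis.

Set Implicit Arguments.
Unset Strict Implicit.
Unset Printing Implicit Defensive.

Import Order.TTheory GRing.Theory Num.Theory.
Import numFieldNormedType.Exports.

Local Open Scope classical_set_scope.
Local Open Scope ring_scope.

(* Lebesgue measure on the Borel sets of R^n, as the n-fold iterated product of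
   the one-dimensional Lebesgue measure; R^n is represented here by
   n.-tuple R, which carries the product sigma-algebra. *)
Section lebesgue_measure_Rn.
Context {R : realType}.
Notation T := (measurableTypeR R).

Definition tcons n (z : T * n.-tuple T) : n.+1.-tuple T :=
  [tuple of z.1 :: z.2].

Lemma measurable_tcons n : measurable_fun [set: T * n.-tuple T] (@tcons n).
Proof. exact: measurable_cons. Qed.

Section lebesgue_cons.
Variables (n : nat) (mu : {sigma_finite_measure set (n.-tuple T) -> \bar R}).

Definition lebesgue_cons : set (n.+1.-tuple T) -> \bar R :=
  pushforward (lebesgue_measure \x mu)%E (@tcons n).

Let lebesgue_cons0 : lebesgue_cons set0 = 0%E.
Proof. by rewrite /lebesgue_cons /pushforward preimage_set0 measure0. Qed.

Let lebesgue_cons_ge0 A : (0 <= lebesgue_cons A)%E.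
Proof. by rewrite /lebesgue_cons /pushforward measure_ge0. Qed.

Let lebesgue_cons_sigma_additive : semi_sigma_additive lebesgue_cons.
Proof.
move=> F mF tF mUF; rewrite /lebesgue_cons /pushforward preimage_bigcup.
have mpre B : measurable B -> measurable (@tcons n @^-1` B).
  by move=> mB; rewrite -[X in measurable X]setTI; exact: measurable_tcons.
apply: measure_semi_sigma_additive.
- by move=> k; exact: mpre.
- by move=> i j _ _ [z [Fiz Fjz]]; apply: tF => //; exists (tcons z).
- by rewrite -preimage_bigcup; exact: mpre.
Qed.

HB.instance Definition _ := isMeasure.Build _ _ _ lebesgue_cons
  lebesgue_cons0 lebesgue_cons_ge0 lebesgue_cons_sigma_additive.

Let lebesgue_cons_sigma_finite : sigma_finite setT lebesgue_cons.
Proof.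
have /sigma_finiteP[F [TF ndF Foo]] := sigma_finiteT (@lebesgue_measure R).
have /sigma_finiteP[G [TG ndG Goo]] := sigma_finiteT mu.
pose hd (t : n.+1.-tuple T) : T := thead t.
pose tl (t : n.+1.-tuple T) : n.-tuple T := [tuple of behead t].
exists (fun k => (hd @^-1` F k) `&` (tl @^-1` G k)).
  apply/seteqP; split=> // t _.
  have [i _ Fi] : (\bigcup_i F i) (hd t) by rewrite -TF.
  have [j _ Gj] : (\bigcup_i G i) (tl t) by rewrite -TG.
  exists (maxn i j) => //; split => /=.
  - by move: Fi; exact/subsetPset/ndF/leq_maxl.
  - by move: Gj; exact/subsetPset/ndG/leq_maxr.
move=> k; have [mF Fk] := Foo k; have [mG Gk] := Goo k; split.
  apply: measurableI; rewrite -[X in measurable X]setTI.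
  - exact: measurable_tnth.
  - exact: measurable_behead.
rewrite /lebesgue_cons /pushforward.
rewrite (_ : _ @^-1` _ = F k `*` G k).
  by rewrite product_measure1E// lte_mul_pinfty// ge0_fin_numE.
have tlE z : tl (tcons z) = z.2 by exact: val_inj.
by apply/seteqP; split=> z /=; rewrite tlE.
Qed.

HB.instance Definition _ := Measure_isSigmaFinite.Build _ _ _ lebesgue_cons
  lebesgue_cons_sigma_finite.

End lebesgue_cons.

Fixpoint lebesgue_Rn n : {sigma_finite_measure set (n.-tuple T) -> \bar R} :=
  match n with
  | 0 => dirac [tuple]
  | m.+1 => lebesgue_cons (lebesgue_Rn m)
  end.

Lemma lebesgue_Rn_box n (A : 'I_n -> set T) : (forall i, measurable (A i)) ->
  lebesgue_Rn n [set v | forall i, A i (tnth v i)] =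
  (\big[*%E/1]_(i < n) lebesgue_measure (A i))%E.
Proof.
elim: n A => [|n IHn] A mA.
  by rewrite big_ord0 /= diracE mem_set// => -[].
rewrite big_ord_recl -(IHn (fun i => A (lift ord0 i)))//.
rewrite -product_measure1E//; last first.
  rewrite (_ : mkset _ = \bigcap_(i in [set: 'I_n])
     ((@tnth n T ^~ i) @^-1` A (lift ord0 i))); last first.
    by apply/seteqP; split=> v /= vA i; [move=> _|]; exact: vA.
  apply: fin_bigcap_measurable => [|i _]; first exact: finite_finset.
  by rewrite -[X in measurable X]setTI; exact: measurable_tnth.
rewrite /= /lebesgue_cons /pushforward; congr product_measure1.
apply/seteqP; split=> -[x v] /=.
  move=> xvA; split; first exact: (xvA ord0).
  by move=> i; have := xvA (lift ord0 i); rewrite tnthS.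
move=> [x0 vA] i; case: (unliftP ord0 i) => [j ->|->]; last exact: x0.
by rewrite tnthS; exact: vA.
Qed.

End lebesgue_measure_Rn.

Section classical_solutions.
Context {R : realType} {n : nat}.
Implicit Types (x : 'rV[R]_n) (t : R) (f : 'rV[R]_n -> R).
Implicit Type u : 'rV[R]_n -> R -> R.

(* The norm of the library on 'rV[R]_n is the maximum norm. *)
Definition euclid_norm x : R := Num.sqrt (\sum_(i < n) x 0 i ^+ 2).

Definition partial (i : 'I_n) f x : R := 'D_(delta_mx 0 i) f x.

Definition laplacian f x : R := \sum_(i < n) partial i (partial i f) x.

Definition has_partial (i : 'I_n) f x : Prop :=
  derivable f x (delta_mx 0 i : 'rV[R]_n).

(* C^0(R^n x [0, +oo)); the values of u at negative times play no role. *)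
Definition C0_closed u : Prop :=
  {within [set z : 'rV[R]_n * R | 0 <= z.2],
    continuous (fun z : 'rV[R]_n * R => u z.1 z.2)}.

Definition C0_open u : Prop :=
  forall z : 'rV[R]_n * R, 0 < z.2 ->
    {for z, continuous (fun z : 'rV[R]_n * R => u z.1 z.2)}.

(* C^{2,1}(R^n x (0, +oo)) *)
Definition C21_open u : Prop :=
  [/\ C0_open u,
      (forall x t, 0 < t -> derivable (u x) t 1) /\
        C0_open (fun x => derive1 (u x)),
      forall i, (forall x t, 0 < t -> has_partial i (u^~ t) x) /\
        C0_open (fun x t => partial i (u^~ t) x) &
      forall i j,
        (forall x t, 0 < t -> has_partial j (partial i (u^~ t)) x) /\
        C0_open (fun x t => partial j (partial i (u^~ t)) x)].

Definition positive_classical_solution (p : R) (u0 : 'rV[R]_n -> R) u : Prop :=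
  [/\ forall x t, 0 <= t -> 0 < u x t,
      C0_closed u,
      C21_open u,
      forall x t, 0 < t ->
        derive1 (u x) t = u x t `^ p * laplacian (u^~ t) x &
      forall x, u x 0 = u0 x].

(* Essential supremum of |f| with respect to Lebesgue measure; it may be +oo. *)
Definition Linfty_norm f : \bar R :=
  Lnorm (@lebesgue_Rn R n) +oo%E (fun v => (f (\row_i tnth v i))%:E).

End classical_solutions.

(* For an injective Lambda this is the inverse of its restriction to [0, +oo);
   its value is 0 outside the range of that restriction. *)
Definition inverse_on_nonneg {R : realType} (Lambda : R -> R) : R -> R :=
  'pinv_(fun=> 0) `[0, +oo[%classic Lambda.

(* Main.v *)
Require Import Defs.
From mathcomp Require Import all_boot all_order all_algebra.
From mathcomp Require Import all_classical all_reals all_analysis.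
From mathcomp Require Import ess_sup_inf lra ring.

Import Order.TTheory GRing.Theory Num.Theory.
Import numFieldNormedType.Exports.

Local Open Scope classical_set_scope.
Local Open Scope ring_scope.

(* On the ball of radius r, the function v(x,t) = y(t) (1 - |x|^2 / r^2) with
   y' = - (2n+1) r^-2 y^(p+1) is a strict subsolution, since phi^p <= phi for
   0 <= phi <= 1 and p >= 1. If y(0) <= u_0 on that ball, then v <= u: at a
   negative minimum of u - v one has u_t <= v_t, Delta u >= Delta v and u < v,
   and Delta v < 0 then gives u_t >= v^p Delta v > v_t.
   Take y(0) = e^{-Lambda(r)} and Lambda(r) = C ln t. For C small,
   y(0)^{-p} = t^{Cp}, and the growth of Lambda gives r <= t^C; both are
   negligible in y(t) = (y(0)^{-p} + p (2n+1) t / r^2)^{-1/p}, so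
   u(0,t) >= y(t) >= C t^{-1/p} r^{2/p}. *)

(** * One-variable derivative tests at a minimum *)

(** Difference quotients from the left are nonpositive. A one-sided test is required because the
    minimum over a space-time cylinder may sit at its final time. *)
Lemma derive1_le0_left_min (R : realFieldType) (f : R -> R) (a b : R) :
  a < b -> derivable f b 1 ->
  (forall s, a <= s -> s <= b -> f b <= f s) -> derive1 f b <= 0.
Proof.
move=> ab df fmin; rewrite derive1E ['D_1 f b]cvg_at_leftE; last exact: df.
apply: limr_le.
  rewrite -(cvg_at_leftE (fun h => h^-1 *: ((f \o shift b) _ - f b)))//.
  apply: cvg_trans df; apply: cvg_app.
  move=> A [e e0 Ae]; exists e => // x xe x0; apply: Ae => //.
  exact/ltr0_neq0.
near=> h.
have h0 : h < 0 by near: h; exists 1 => /=.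
apply: mulr_le0_ge0; first by rewrite invr_le0 ltW.
rewrite subr_ge0 [_%:A]mulr1; apply: fmin; last by rewrite /=; lra.
near: h; exists (b - a); first by rewrite /= subr_gt0.
move=> h /=; rewrite distrC subr0 => /ltr_normlP[h1 h2] _; lra.
Unshelve. all: by end_near. Qed.

(** Otherwise [derive1 f], which vanishes at [c], is negative just to the right of [c], and the mean
    value theorem gives a value of [f] below [f c]. *)
Lemma derive1_derive1_ge0_min (R : realType) (f : R -> R) (c e : R) :
  0 < e -> (forall s, `|s - c| < e -> derivable f s 1) ->
  derivable (derive1 f) c 1 -> (forall s, `|s - c| < e -> f c <= f s) ->
  0 <= derive1 (derive1 f) c.
Proof.
move=> e0 df ddf fmin; rewrite leNgt; apply/negP => ddf0.
have in_ball s : s \in `]c - e, c + e[%R -> `|s - c| < e.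
  by rewrite in_itv/= ltr_distl.
have f'c : derive1 f c = 0.
  have cab : c \in `]c - e, c + e[%R by rewrite in_itv/=; lra.
  have ? : is_derive c (1 : R) f 0.
    apply: (@derive1_at_min R f (c - e) (c + e)) (cab) _ => [|t|t].
    - by rewrite lerD2l (le_trans _ (ltW e0))// oppr_le0 ltW.
    - by move/in_ball; exact: df.
    - by move/in_ball; exact: fmin.
  by rewrite derive1E derive_val.
have : h^-1 *: ((derive1 f \o shift c) (h *: 1) - derive1 f c) @[h --> 0^'] -->
    derive1 (derive1 f) c by rewrite [in X in _ --> X]derive1E; exact: ddf.
move=> /cvgr_lt/(_ _ ddf0) [d /= d0 dlt].
pose m := Num.min d e / 2.
have [m0 md me] : [/\ 0 < m, m < d & m < e].
  by split; rewrite /m; case: (ltP d e); lra.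
have [] := @MVT _ f (derive1 f) c (c + m).
- lra.
- move=> x; rewrite in_itv/= => /andP[x1 x2].
  have dfx : derivable f x 1 by apply: df; rewrite ltr_distl; lra.
  by rewrite derive1E; exact: DeriveDef.
- apply: derivable_within_continuous => x; rewrite in_itv/= => /andP[x1 x2].
  by apply: df; rewrite ltr_distl; lra.
move=> x; rewrite in_itv/= => /andP[x1 x2] fE.
have f'x : derive1 f x < 0.
  have /= := dlt (x - c).
  rewrite distrC subr0 [_%:A]mulr1 subrK f'c subr0.
  have -> : `|x - c| < d by rewrite ger0_norm; lra.
  have -> : x - c != 0 by lra.
  move=> /(_ isT isT); rewrite pmulr_rlt0// invr_gt0; lra.
have : f c <= f (c + m) by apply: fmin; rewrite ltr_distl; lra.
rewrite -subr_ge0 fE; nra.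
Qed.

Lemma is_derive_quadratic (R : realType) (a b s : R) :
  is_derive s (1 : R) (fun r => a * r + b * r ^+ 2) (a + 2 * b * s).
Proof.
apply: is_derive_eq.
by rewrite /GRing.scale/=; ring.
Qed.

(* Subtracting the parabola reduces this to the second derivative test. *)
Lemma derive1_derive1_ge_parabola (R : realType) (f : R -> R) (a b e : R) :
  0 < e -> (forall s, derivable f s 1) -> derivable (derive1 f) 0 1 ->
  (forall s, `|s| < e -> f 0 + a * s + b * s ^+ 2 <= f s) ->
  2 * b <= derive1 (derive1 f) 0.
Proof.
move=> e0 df ddf fge.
pose g : R -> R := f - (fun s => a * s + b * s ^+ 2).
have gE s : g s = f s - (a * s + b * s ^+ 2) by [].
have dg s : is_derive s (1 : R) g (derive1 f s - (a + 2 * b * s)).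
  apply: is_deriveB; last exact: is_derive_quadratic.
  by rewrite derive1E; exact: (derivableP (df s)).
have g'E : derive1 g = derive1 f - (fun s => a + 2 * b * s).
  by apply/funext => s; rewrite derive1E derive_val.
have dg' :
    is_derive (0 : R) (1 : R) (derive1 g) (derive1 (derive1 f) 0 - 2 * b).
  rewrite g'E; apply: is_deriveB; first by rewrite derive1E; exact/derivableP.
  by apply: is_derive_eq; rewrite /GRing.scale/=; ring.
rewrite -subr_ge0 -(@derive_val _ _ _ _ _ _ _ dg') -derive1E.
apply: (@derive1_derive1_ge0_min R g 0 e e0).
- by move=> s _; case: (dg s).
- by case: dg'.
- by move=> s; rewrite subr0 => /fge; rewrite !gE; lra.
Qed.

(** * Point values and the essential supremum *)

Lemma lebesgue_Rn_cube_gt0 (R : realType) n (x : 'rV[R]_n) (d : R) : 0 < d ->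
  (0 < lebesgue_Rn n [set v : n.-tuple (measurableTypeR R) |
        forall i, ball (x ord0 i) d (tnth v i)])%E.
Proof.
move=> d0; rewrite (@lebesgue_Rn_box R n (fun i => ball (x ord0 i) d));
  last first.
  by move=> i; rewrite ball_itv; exact: measurable_itv.
elim/big_ind : _ => //; first by move=> y z; exact: mule_gt0.
move=> i _; rewrite ball_itv lebesgue_measure_itv/= lte_fin ifT; last by lra.
by rewrite -EFinD lte_fin; lra.
Qed.

Lemma measurable_cube (R : realType) n (x : 'rV[R]_n) (d : R) :
  measurable [set v : n.-tuple (measurableTypeR R) |
        forall i, ball (x ord0 i) d (tnth v i)].
Proof.
rewrite (_ : mkset _ = \bigcap_(i in [set: 'I_n])
  ((fun v : n.-tuple (measurableTypeR R) => tnth v i) @^-1`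
     ball (x ord0 i) d)); last first.
  by apply/seteqP; split=> v /= vA i; [move=> _|]; exact: vA.
apply: fin_bigcap_measurable => [|i _]; first exact: finite_finset.
rewrite -[X in measurable X]setTI; apply: measurable_tnth => //.
by rewrite ball_itv; exact: measurable_itv.
Qed.

(** By continuity [f] stays within [e] of [f x] on a cube about [x]. The cube has positive measure,
    so the essential supremum cannot lie below [|f x| - e]. *)
Lemma Linfty_norm_ge (R : realType) n (f : 'rV[R]_n -> R) (x : 'rV[R]_n) :
  {for x, continuous f} -> (`|f x|%:E <= Linfty_norm f)%E.
Proof.
move=> fx; rewrite /Linfty_norm unlock.
have cube_gt0 := @lebesgue_Rn_cube_gt0 R n x.
(* The norm with exponent [+oo] is the essential supremum only when the whole space has positive
   measure; a cube of radius 1 certifies this. *)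
rewrite ifT; last first.
  apply: (lt_le_trans (cube_gt0 _ (ltr01))); apply: le_measure => //.
  - by rewrite inE; exact: measurable_cube.
  - by rewrite inE.
apply/lee_subgt0Pr => e e0.
rewrite leNgt; apply/negP => ylt.
have [B [mB B0 yB]] := ess_sup_ge (lebesgue_Rn n)
  (abse \o (fun v => (f (\row_i tnth v i))%:E)).
have /cvgrPdist_lt/(_ e e0)/nbhs_ballP[d /= d0 fd] := fx.
have := cube_gt0 _ d0; apply/negP; rewrite -leNgt -B0.
apply: le_measure; rewrite ?inE//; first exact: measurable_cube.
move=> v vd; apply: yB => /=; apply/negP; rewrite -ltNge.
apply: (lt_le_trans ylt); rewrite -EFinB lee_fin.
have : `|f x - f (\row_i tnth v i)| < e.
  apply: fd; split=> // i j.
  by rewrite ord1 mxE; exact: vd.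
move=> fe; rewrite lerBlDr -lerBlDl.
by rewrite (le_trans (lerB_dist _ _))// ltW.
Qed.

(** * Restriction to lines and the squared norm *)

(** This turns directional derivatives into ordinary ones, so that the one-variable tests apply to
    first and iterated partial derivatives. *)
Lemma slice_quotient (R : realType) n (f : 'rV[R]_n -> R) x v (s : R) :
  (fun h : R => h^-1 *:
    (((fun r : R => f (x + r *: v)) \o shift s) (h *: (1 : R)) - f (x + s *: v))) =
  (fun h : R => h^-1 *: ((f \o shift (x + s *: v)) (h *: v) - f (x + s *: v))).
Proof. by apply/funext => h /=; rewrite [h%:A]mulr1 scalerDl addrCA. Qed.

Lemma derivable_slice (R : realType) n (f : 'rV[R]_n -> R) x v (s : R) :
  derivable f (x + s *: v) v -> derivable (fun r : R => f (x + r *: v)) s 1.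
Proof. by rewrite /derivable slice_quotient. Qed.

Lemma derive1_slice (R : realType) n (f : 'rV[R]_n -> R) x v (s : R) :
  derive1 (fun r : R => f (x + r *: v)) s = 'D_v f (x + s *: v).
Proof. by rewrite derive1E /derive slice_quotient. Qed.

Section sqnorm.
Context {R : realType} {n : nat}.
Implicit Type x : 'rV[R]_n.

Definition sqnorm x : R := \sum_(i < n) x 0 i ^+ 2.

Lemma sqnorm_ge0 x : 0 <= sqnorm x.
Proof. by apply: sumr_ge0 => i _; exact: sqr_ge0. Qed.

Lemma sqr_coord_le_sqnorm x i : x 0 i ^+ 2 <= sqnorm x.
Proof.
rewrite /sqnorm (bigD1 i)//= lerDl.
by apply: sumr_ge0 => j _; exact: sqr_ge0.
Qed.

Lemma sqnorm_line x i s :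
  sqnorm (x + s *: delta_mx 0 i) = sqnorm x + 2 * s * x 0 i + s ^+ 2.
Proof.
rewrite /sqnorm (bigD1 i)//= [in RHS](bigD1 i)//= !mxE !eqxx/=.
rewrite (eq_bigr (fun j => x 0 j ^+ 2)); first by ring.
by move=> j /negPf ji; rewrite !mxE ji /= mulr0 addr0.
Qed.

Lemma continuous_sqnorm : continuous (@sqnorm : 'rV[R]_n -> R).
Proof.
move=> x; apply: cvg_big => [||i _].
- exact: add_continuous.
- exact: nbhs_filter.
apply: (@cvg_comp _ _ _ (fun y : 'rV[R]_n => y 0 i) (fun r : R => r ^+ 2)).
  exact: coord_continuous.
exact: exprn_continuous.
Qed.
End sqnorm.

(** * The time factor of the subsolution *)

Section decay.
Context {R : realType}.
Implicit Types p k a t : R.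

(* The solution of y' = - k y^(p+1), y(0) = a. *)
Definition decay p k a t : R := (a `^ (- p) + p * k * t) `^ (- p^-1).

Lemma decay_base_gt0 p k a t : 0 < p -> 0 < k -> 0 < a -> 0 <= t ->
  0 < a `^ (- p) + p * k * t.
Proof.
move=> p0 k0 a0 t0.
by rewrite ltr_wpDr ?powR_gt0// !mulr_ge0// ltW.
Qed.

Lemma decay_gt0 p k a t : 0 < p -> 0 < k -> 0 < a -> 0 <= t ->
  0 < decay p k a t.
Proof. by move=> *; rewrite powR_gt0// decay_base_gt0. Qed.

Lemma decay0 p k a : 0 < p -> 0 < a -> decay p k a 0 = a.
Proof.
move=> p0 a0.
by rewrite /decay mulr0 addr0 -powRrM mulrNN mulfV ?gt_eqF// powRr1// ltW.
Qed.

Lemma is_derive_decay p k a t : 0 < p -> 0 < k -> 0 < a -> 0 <= t ->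
  is_derive t (1 : R) (decay p k a) (- k * decay p k a t `^ (p + 1)).
Proof.
move=> p0 k0 a0 t0.
have b0 := decay_base_gt0 p k a t p0 k0 a0 t0.
pose b := fun r : R => a `^ (- p) + p * k * r.
have db : is_derive t (1 : R) b (p * k).
  by apply: is_derive_eq; rewrite /GRing.scale/=; ring.
have dp : is_derive (b t) (1 : R) (@powR R ^~ (- p^-1)) _ :=
  is_derive1_powR _ b0.
apply: is_derive_eq; first exact: (is_derive1_comp dp db).
(* The exponents agree because -(p + 1)/p = -1/p - 1. *)
have -> : decay p k a t `^ (p + 1) = b t `^ (- p^-1 - 1).
  by rewrite -powRrM; congr (_ `^ _); field; rewrite gt_eqF.
by rewrite -/(b t); field; rewrite gt_eqF.
Qed.
End decay.

(** * Comparison with the subsolution *)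

(* The strict subsolution inequality at a point where u <= v = y phi: U, L and
   Ut are the values of u, its Laplacian and its time derivative. *)
Lemma subsolution_contradiction (R : realType) (p m k y phi U L Ut : R) :
  1 <= p -> 0 < k -> 0 < y -> 0 < phi -> phi <= 1 -> 0 <= m ->
  0 < U -> U <= y * phi -> - (m * k * y) <= L -> Ut = U `^ p * L ->
  Ut <= - ((m + 1) * k) * y `^ (p + 1) * phi -> False.
Proof.
move=> p1 k0 y0 phi0 phi1 m0 U0 Uy Lge -> Utle.
have p0 : 0 <= p by exact: le_trans p1.
have Up : U `^ p <= y `^ p * phi.
  apply: (@le_trans _ _ ((y * phi) `^ p)).
    by apply: ge0_ler_powR => //; rewrite nnegrE ?mulr_ge0// ltW.
  rewrite powRM; [|exact: ltW..].
  by rewrite ler_wpM2l ?powR_ge0// ge1r_powR// phi0 phi1.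
have yp : y `^ (p + 1) = y `^ p * y.
  by rewrite powRD ?(powRr1 (ltW y0))// (gt_eqF y0) implybT.
have yp0 : 0 < y `^ p by rewrite powR_gt0.
have Up0 : 0 < U `^ p by rewrite powR_gt0.
(* This is the gap between the upper bound for [Ut], with factor [m + 1], and the lower bound for
   [U^p L], with factor [m]. *)
have kyy : 0 < k * y * (y `^ p * phi) by rewrite !mulr_gt0.
have h1 : U `^ p * (m * k * y) <= (y `^ p * phi) * (m * k * y).
  apply: ler_wpM2r => //; apply: mulr_ge0; last exact: ltW.
  by apply: mulr_ge0 => //; exact: ltW.
have h2 : - (U `^ p * (m * k * y)) <= U `^ p * L.
  by rewrite -mulrN; apply: ler_wpM2l => //; exact: ltW.
move: Utle; rewrite yp; lra.
Qed.

Section comparison.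
Context {R : realType} {n : nat} (p : R) (u0 : 'rV[R]_n -> R).
Context (u : 'rV[R]_n -> R -> R) (rho a : R).
Implicit Types x z : 'rV[R]_n.
Hypotheses (p_ge1 : 1 <= p) (u_sol : positive_classical_solution p u0 u).
Hypotheses (rho_gt0 : 0 < rho) (a_gt0 : 0 < a).
Hypothesis u0_ge : forall x, sqnorm x <= rho ^+ 2 -> a <= u0 x.

(** The summand 2n is the Laplacian of [sqnorm]; the extra 1 makes the subsolution strict. *)
Let k : R := (n%:R * 2 + 1) * rho ^- 2.
Let y := decay p k a.
Let bump (x : 'rV[R]_n) : R := 1 - rho ^- 2 * sqnorm x.

Let p_gt0 : 0 < p. Proof. exact: lt_le_trans p_ge1. Qed.
Let k_gt0 : 0 < k.
Proof. by rewrite mulr_gt0 ?invr_gt0 ?exprn_gt0// ltr_wpDl// mulr_ge0. Qed.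

(** A box in space, so that compactness comes from a product of segments. The barrier is nonpositive
    in the box outside the open ball, so a negative minimum of [u - v] still lies in that ball. *)
Let cylinder (T : R) : set ('rV[R]_n * R) :=
  [set x : 'rV[R]_n | forall i, `[- rho, rho]%classic (x ord0 i)] `*`
  `[0, T]%classic.

Let ball_in_box x : sqnorm x < rho ^+ 2 -> forall i, `|x 0 i| < rho.
Proof.
move=> xr i; rewrite -ltr_sqr ?nnegrE// ?(ltW rho_gt0)// real_normK ?num_real//.
exact: le_lt_trans (sqr_coord_le_sqnorm x i) xr.
Qed.

Let bump_gt0 x : (0 < bump x) = (sqnorm x < rho ^+ 2).
Proof. by rewrite subr_gt0 mulrC ltr_pdivrMr ?exprn_gt0// mul1r. Qed.

Let within_cylinder T : {within cylinder T,
  continuous (fun z : 'rV[R]_n * R => u z.1 z.2 - y z.2 * bump z.1)}.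
Proof.
have [_ u_cont _ _ _] := u_sol.
have u_cyl : {within cylinder T,
    continuous (fun z : 'rV[R]_n * R => u z.1 z.2)}.
  apply: continuous_subspaceW u_cont => -[x t] [_] /=.
  by rewrite in_itv/= => /andP[].
have v_cyl : {within cylinder T,
    continuous (fun z : 'rV[R]_n * R => y z.2 * bump z.1)}.
  apply: continuous_in_subspaceT => -[x t]; rewrite inE => -[_] /=.
  rewrite in_itv/= => /andP[t0 _].
  apply: cvgM.
    apply: (@cvg_comp _ _ _ (snd : 'rV[R]_n * R -> R) y); first exact: cvg_snd.
    apply: (@differentiable_continuous _ _ _ t y); apply/derivable1_diffP.
    by have [] := is_derive_decay p k a t p_gt0 k_gt0 a_gt0 t0.
  apply: (@cvg_comp _ _ _ (fst : 'rV[R]_n * R -> 'rV[R]_n) bump).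
    exact: cvg_fst.
  apply: cvgB; first exact: cst_continuous.
  by apply: cvgM; [exact: cst_continuous|exact: continuous_sqnorm].
by move=> z; exact: (cvgB (u_cyl z) (v_cyl z)).
Qed.

Lemma barrier_le_solution x t : 0 <= t -> y t * bump x <= u x t.
Proof.
have [u_gt0 _ [_ [du _] dxu dxxu] u_eq u_init] := u_sol.
move=> t0; rewrite leNgt; apply/negP => u_lt.
have y_gt0 r : 0 <= r -> 0 < y r by exact: decay_gt0.
have bumpx : 0 < bump x.
  by rewrite -(pmulr_rgt0 _ (y_gt0 _ t0)); exact: lt_trans (u_gt0 x t t0) u_lt.
have K_xt : cylinder t (x, t).
  split=> /=; last by rewrite in_itv/= t0 lexx.
  move=> i; rewrite in_itv/= -ler_norml ltW//.
  by apply: ball_in_box; rewrite -bump_gt0.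
have K_compact : compact (cylinder t).
  apply: compact_setX; last exact: segment_compact.
  apply: (@rV_compact _ _ (fun=> `[- rho, rho]%classic)) => i.
  exact: segment_compact.
have [[z s]] :=
  compact_EVT_min (ex_intro _ _ K_xt) K_compact (within_cylinder t).
rewrite inE => -[/= z_box]; rewrite in_itv/= => /andP[s_ge0 s_le] w_min.
have w_le z' s' : cylinder t (z', s') ->
    u z s - y s * bump z <= u z' s' - y s' * bump z'.
  by move=> K'; apply: (w_min (z', s')); rewrite inE.
have u_lt_zs : u z s < y s * bump z.
  by have := w_le _ _ K_xt; lra.
(* Positivity of [u] forces the barrier to be positive at the minimum, which puts [z] in the open
   ball. *)
have bumpz : 0 < bump z.
  rewrite -(pmulr_rgt0 _ (y_gt0 _ s_ge0)).
  exact: lt_trans (u_gt0 z s s_ge0) u_lt_zs.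
have bumpz_le1 : bump z <= 1.
  by rewrite gerBl mulr_ge0 ?sqnorm_ge0// invr_ge0 exprn_ge0// ltW.
have z_ball : sqnorm z < rho ^+ 2 by rewrite -bump_gt0.
(* At time 0 the barrier is at most [a], hence at most [u0], on the ball. *)
have s_gt0 : 0 < s.
  rewrite lt_neqAle s_ge0 andbT; apply/eqP => s0.
  move: u_lt_zs; rewrite -s0 u_init /y decay0//; apply/negP; rewrite -leNgt.
  by rewrite (le_trans _ (u0_ge z (ltW z_ball)))// ler_piMr// ltW.
have ut_le : derive1 (u z) s <= - k * y s `^ (p + 1) * bump z.
  have dy := is_derive_decay p k a s p_gt0 k_gt0 a_gt0 s_ge0.
  have dw : is_derive s (1 : R) (u z - (bump z \*: y))
      (derive1 (u z) s - bump z *: (- k * y s `^ (p + 1))).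
    apply: is_deriveB.
    by rewrite derive1E; exact: (derivableP (du z s s_gt0)).
  have := @derive1_le0_left_min _ (u z - (bump z \*: y)) 0 s s_gt0.
  rewrite derive1E derive_val subr_le0 [_ *: (_ * _)]mulrC; apply => //.
  move=> r r0 rs; have := w_le z r; rewrite !(mulrC _ (bump z)); apply.
  by split=> //=; rewrite in_itv/= r0 (le_trans rs).
have lap_ge : - (n%:R * 2 * rho ^- 2 * y s) <= laplacian (u^~ s) z.
  have -> : - (n%:R * 2 * rho ^- 2 * y s) =
      \sum_(i < n) 2 * - (rho ^- 2 * y s).
    by rewrite sumr_const card_ord -mulr_natl; ring.
  apply: ler_sum => i _.
  pose f r := u (z + r *: delta_mx 0 i) s.
  have f'E : derive1 f = fun r => partial i (u^~ s) (z + r *: delta_mx 0 i).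
    by apply/funext => r; exact: (derive1_slice R n (u^~ s)).
  have -> : partial i (partial i (u^~ s)) z = derive1 (derive1 f) 0.
    by rewrite f'E derive1_slice scale0r addr0.
  (* Minimality keeps [f] above [f 0] plus the increment of the barrier, a quadratic in [r]. For
     [|r| < rho - |z_i|] the point stays in the box. *)
  apply: (@derive1_derive1_ge_parabola _ f
    (- (2 * rho ^- 2 * y s * z 0 i)) _ (rho - `|z 0 i|)).
  - by rewrite subr_gt0; exact: ball_in_box.
  - by move=> r; apply: (@derivable_slice R n (u^~ s)); exact: (proj1 (dxu i)).
  - rewrite f'E; apply: (@derivable_slice R n (partial i (u^~ s))).
    exact: (proj1 (dxxu i i)).
  move=> r rlt; have := w_le (z + r *: delta_mx 0 i) s.
  rewrite /f scale0r addr0 /bump sqnorm_line => H.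
  suff /H : cylinder t (z + r *: delta_mx 0 i, s) by lra.
  split=> /=; last by rewrite in_itv/= s_ge0.
  move=> j; rewrite in_itv/= !mxE eqxx/=; case: eqP => [->|_] /=.
    rewrite mulr1 -ler_norml (le_trans (ler_normD _ _))//; lra.
  by rewrite mulr0 addr0; have := z_box j; rewrite /= in_itv.
apply: (@subsolution_contradiction R p (n%:R * 2) (rho ^- 2) (y s) (bump z)
  (u z s) (laplacian (u^~ s) z) (derive1 (u z) s)) => //.
- by rewrite invr_gt0 exprn_gt0.
- exact: y_gt0.
- exact: u_gt0.
- exact: ltW.
- exact: u_eq.
Qed.

End comparison.

(** * Choice of the radius and the final estimate *)

(** Beyond some [S] the growth condition gives [ln s <= Lambda s]. This bounds [Lambda] below for
    the intermediate value theorem and also yields [ln r <= l] at the point found. *)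
Lemma growth_surj (R : realType) (Lambda : R -> R) :
  {within `[0, +oo[%classic, continuous Lambda} ->
  (fun s => Lambda s / ln s) @ +oo --> +oo ->
  exists2 S, 1 <= S & forall l, Lambda S <= l ->
    exists r, [/\ S <= r, Lambda r = l & ln r <= l].
Proof.
move=> cL /cvgryPge/(_ 1)[M [_ HM]].
(* The 2 makes [ln] positive, so the quotient can be cleared; [M + 1] passes the strict threshold
   [M]. *)
pose S := Num.max 2 (M + 1).
have S2 : 2 <= S by rewrite le_max lexx.
have SM : M + 1 <= S by rewrite le_max lexx orbT.
have lnL s : S <= s -> ln s <= Lambda s.
  move=> Ss; have /HM/= : M < s by lra.
  by rewrite ler_pdivlMr ?mul1r// ln_gt0//; lra.
exists S => [|l lS]; first by lra.
pose b := Num.max S (expR l).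
have Sb : S <= b by rewrite le_max lexx.
have lb : l <= Lambda b.
  apply: le_trans (lnL b Sb); rewrite -{1}(expRK l) ler_ln ?posrE ?expR_gt0//.
    by rewrite le_max lexx orbT.
  by rewrite (lt_le_trans _ Sb)//; lra.
have [||r] := @IVT _ Lambda S b l Sb.
- apply: continuous_subspaceW cL => x /=; rewrite !in_itv/= andbT.
  by move=> /andP[Sx _]; lra.
- by rewrite ge_min lS le_max lb orbT.
rewrite in_itv/= => /andP[Sr _] Lr; exists r; split=> //.
by rewrite -Lr; exact: lnL.
Qed.

Lemma continuous_time_slice (R : realType) n (u : 'rV[R]_n -> R -> R) x t :
  0 < t -> C0_open u -> {for x, continuous (u^~ t)}.
Proof.
move=> t0 /(_ (x, t) t0) cu.
by apply: (@continuous2_cvg _ _ _ _ (nbhs x) _ id (cst t) u x t cu);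
  [exact: cvg_id|exact: cvg_cst].
Qed.

(** The last hypothesis absorbs the initial term into [t / r^2], so the base of [decay] is at most
    [(1 + p c) t / r^2]; the power -1/p reverses the inequality. *)
Lemma decay_ge (R : realType) (p c a r t : R) :
  0 < p -> 0 < r -> 0 < t -> 0 < c -> 0 < a -> a `^ (- p) * r ^+ 2 <= t ->
  (1 + p * c) `^ (- p^-1) * t `^ (- p^-1) * r `^ (2 / p) <=
    decay p (c * r ^- 2) a t.
Proof.
move=> p0 r0 t0 c0 a0 art.
have rV0 : 0 < r ^- 2 by rewrite invr_gt0 exprn_gt0.
have pc0 : 0 < p * c by exact: mulr_gt0.
have -> : (1 + p * c) `^ (- p^-1) * t `^ (- p^-1) * r `^ (2 / p) =
    ((1 + p * c) * t * r ^- 2) `^ (- p^-1).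
  rewrite [RHS]powRM ?mulr_ge0// ?(ltW rV0) ?(ltW t0)//; last by lra.
  rewrite powRM ?(ltW t0)//; last by lra.
  by rewrite -(powR_invn 2) ?(ltW r0)// -powRrM mulrNN.
have b0 := @decay_base_gt0 R p (c * r ^- 2) a t p0
  (mulr_gt0 c0 rV0) a0 (ltW t0).
have le_base : a `^ (- p) + p * (c * r ^- 2) * t <= (1 + p * c) * t * r ^- 2.
  have : a `^ (- p) <= t * r ^- 2 by rewrite ler_pdivlMr ?exprn_gt0.
  lra.
have b0' := lt_le_trans b0 le_base.
rewrite /decay !(powRN _ p^-1) lef_pV2 ?posrE ?powR_gt0//.
apply: ge0_ler_powR => //; first by rewrite invr_ge0 ltW.
  by rewrite nnegrE ltW.
by rewrite nnegrE ltW.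
Qed.

Theorem theorem1p6 (R : realType) (n : nat) (p : R) (Lambda : R -> R)
    (u0 : 'rV[R]_n -> R) (u : 'rV[R]_n -> R -> R)
    (n_gt0 : (0 < n)%N) (p_ge1 : 1 <= p)
    (Lambda_cont : {within `[0, +oo[%classic, continuous Lambda})
    (Lambda_incr : {in `[0, +oo[ &, {homo Lambda : s r / s < r}})
    (Lambda_growth : (fun s => Lambda s / ln s) @ +oo --> +oo)
    (u0_cont : continuous u0)
    (u_sol : positive_classical_solution p u0 u)
    (u0_lower : forall x : 'rV[R]_n, expR (- Lambda (euclid_norm x)) <= u0 x) :
  exists t0 C : R,
    [/\ 0 < t0, 0 < C &
      forall t : R, t0 <= t ->
        (Lambda @` `[0, +oo[%classic) (C * ln t) /\
        ((C * t `^ (- (1 / p)) *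
           inverse_on_nonneg Lambda (C * ln t) `^ (2 / p))%:E
         <= Linfty_norm (u^~ t))%E].
Proof.
have [S S1 surjS] := @growth_surj R Lambda Lambda_cont Lambda_growth.
have p0 : 0 < p by exact: lt_le_trans p_ge1.
pose c : R := n%:R * 2 + 1.
have c0 : 0 < c by rewrite ltr_wpDl// mulr_ge0.
pose K := (1 + p * c) `^ (- p^-1).
(* With [C p <= 1/4], and hence [C <= 1/4], one gets [a^(-p) = t^(C p) <= t^(1/4)] and
   [r^2 <= t^(2 C) <= t^(1/2)]; their product is at most [t] once [ln t >= 0]. The bound by [K]
   serves the final constant. *)
pose C := Num.min (4 * p)^-1 K.
have K0 : 0 < K by rewrite powR_gt0// ltr_wpDr ?mulr_ge0// ltW.
have C0 : 0 < C by rewrite lt_min K0 invr_gt0 mulr_gt0.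
have CK : C <= K by rewrite ge_min lexx orbT.
have Cp : C * p <= 4^-1.
  rewrite -ler_pdivlMr// -invfM [4 * p]mulrC; rewrite ge_min mulrC lexx//.
have C4 : C <= 4^-1 by apply: le_trans Cp; rewrite ler_peMr// ltW.
have Lambda_le : {in `[0, +oo[ &, {mono Lambda : s r / s <= r}}.
  exact: le_mono_in.
(* This time makes [C ln t >= Lambda S], as [surjS] requires; the absolute value also ensures
   [ln t >= 0]. *)
exists (expR (`|Lambda S| / C)), C; split=> // [|t t0t]; first exact: expR_gt0.
have t0 : 0 < t by exact: lt_le_trans (expR_gt0 _) t0t.
have lnt : `|Lambda S| / C <= ln t by rewrite -ler_expR lnK.
have lnt0 : 0 <= ln t by apply: le_trans lnt; rewrite divr_ge0 ?(ltW C0).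
have [|r [Sr Lr ln_r]] := surjS (C * ln t).
  by rewrite (le_trans (ler_norm _))// mulrC -ler_pdivrMr.
have r0 : 0 < r by lra.
have r_itv : r \in `[0, +oo[ by rewrite in_itv/= andbT ltW.
(* Since [C ln t] is the value of [Lambda] at [r >= 0], the partial inverse does not return its
   default 0. *)
have -> : inverse_on_nonneg Lambda (C * ln t) = r.
  rewrite /inverse_on_nonneg -Lr pinvKV ?inE// => x y /[!inE] x0 y0.
  by apply: (inc_inj_in Lambda_le).
split; first by exists r.
pose a := expR (- Lambda r).
have u0_ge x : sqnorm x <= r ^+ 2 -> a <= u0 x.
  move=> xr; apply: le_trans (u0_lower x); rewrite ler_expR lerN2.
  rewrite Lambda_le//; last by rewrite in_itv/= andbT sqrtr_ge0.
  by rewrite -[leRHS](ger0_norm (ltW r0)) -sqrtr_sqr ler_sqrt ?sqr_ge0.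
(* The comparison is evaluated at the origin, where the spatial factor is 1. *)
have := @barrier_le_solution R n p u0 u r a p_ge1 u_sol r0 (expR_gt0 _) u0_ge
  0 t (ltW t0).
rewrite /sqnorm big1 => [|i _]; last by rewrite mxE expr0n.
rewrite mulr0 subr0 mulr1 => decay_le.
have [u_gt0 _ [cu _ _ _] _ _] := u_sol.
have cut := @continuous_time_slice R n u 0 t t0 cu.
apply: le_trans (Linfty_norm_ge _ _ _ _ cut).
rewrite lee_fin (le_trans _ (ler_norm _))// (le_trans _ decay_le)//.
apply: le_trans (@decay_ge R p c a r t p0 r0 t0 c0 (expR_gt0 _) _); last first.
  have -> : a `^ (- p) = expR (p * (C * ln t)).
    by rewrite /a Lr -expRM mulrNN mulrC.
  rewrite -[r in r ^+ 2]lnK ?posrE// -expRM_natl -expRD.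
  rewrite -[leRHS]lnK ?posrE// ler_expR.
  have := ler_wpM2r lnt0 Cp; have := ler_wpM2r lnt0 C4; lra.
rewrite div1r; apply: ler_wpM2r; first exact: powR_ge0.
by apply: ler_wpM2r; first exact: powR_ge0.
Qed.
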